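(* Let $N$ be a finitely generated torsion-free nilpotent group of nilpotency class $c$, let $H\le N$ be a subgroup of finite index, and let $\phi:H\to N$ be a homomorphism with induced morphisms $\phi_i:H_iN_{i+1}/N_{i+1}\to N_i/N_{i+1}$ and associated matrices $M_i\in\mathbb Q^{k_i\times k_i}$ ($1\le i\le c$). Then \[R(\phi)=[N:H]\cdot\big|\det(I_{\sum k_i}-M)\big|_\infty,\qquad M=\mathrm{diag}(M_1,M_2,\dots,M_c)\ \text{(block diagonal)}.\]
   Context: The lower central series of a group $K$ is $\gamma_1(K)=K$, $\gamma_{i+1}(K)=[K,\gamma_i(K)]$. For $L\le K$, the isolator is $\sqrt[K]{L}=\{x\in K:\exists m>0,\ x^m\in L\}$. Put $N_i=\sqrt[N]{\gamma_i(N)}$ and $H_i=\sqrt[H]{\gamma_i(H)}$, with $N_{c+1}=1$. Each $N_i/N_{i+1}$ is free abelian of some rank $k_i$. Fix a Malcev basis: elements $a_{i,j}\in N_i$ ($1\le j\le k_i$) whose cosets form a free basis of $N_i/N_{i+1}$. This identifies $N_i/N_{i+1}$ with $\mathbb Z^{k_i}$ via $a_{i,j}N_{i+1}\mapsto e_j$. The map $\phi_i:H_iN_{i+1}/N_{i+1}\to N_i/N_{i+1}$, $hN_{i+1}\mapsto\phi(h)N_{i+1}$ for $h\in H_i$, is a well-defined homomorphism. Under the identification, $H_iN_{i+1}/N_{i+1}$ is a finite-index subgroup $B_i\mathbb Z^{k_i}$ (with $B_i\in\mathbb Z^{k_i\times k_i}$, $\det B_i\neq0$), and $M_i\in\mathbb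 Q^{k_i\times k_i}$ is the unique matrix with $\phi_i(z)=M_iz$. Generalized twisted conjugacy: for a group $K$, a finite-index subgroup $L\le K$ and a homomorphism $\phi:L\to K$, set $\alpha\sim_\phi\beta\iff\exists\gamma\in L:\ \alpha=\gamma\beta\phi(\gamma^{-1})$. $R(\phi)\in\mathbb Z_{>0}\cup\{\infty\}$ is the number of classes. $|a|_\infty=|a|$ for $a\neq 0$ and $|0|_\infty=\infty$. *)

(* Defs.v *)
From mathcomp Require Import all_boot all_order all_algebra.
Set Implicit Arguments. Unset Strict Implicit. Unset Printing Implicit Defensive.
Import Order.TTheory GRing.Theory Num.Theory.

(* A group: carrier with multiplication, inverse, unit, and the
   (one-sided, hence sufficient) group axioms. *)
Record group := Group {
  gcar :> Type;
  gmul : gcar -> gcar -> gcar;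
  ginv : gcar -> gcar;
  gone : gcar;
  gmulA : forall x y z, gmul x (gmul y z) = gmul (gmul x y) z;
  gmul1 : forall x, gmul gone x = x;
  gmulV : forall x, gmul (ginv x) x = gone }.

Section GroupDefs.
Variable G : group.
Local Notation "x * y" := (gmul x y).
Local Notation "x ^-1" := (ginv x).
Local Notation one := (gone G).

Fixpoint gpow (x : G) (n : nat) : G :=
  match n with 0 => one | S m => x * gpow x m end.
Definition zpow (x : G) (z : int) : G :=
  match z with Posz n => gpow x n | Negz n => (gpow x n.+1)^-1 end.

Definition commg (x y : G) : G := x^-1 * (y^-1 * (x * y)).

Definition full : G -> Prop := fun _ => True.
Definition is_subgroup (K : G -> Prop) : Prop :=
  [/\ K one, (forall x y, K x -> K y -> K (x * y)) & (forall x, K x -> K x^-1)].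

Definition gen (S : G -> Prop) : G -> Prop :=
  fun x => forall K, is_subgroup K -> (forall y, S y -> K y) -> K x.

Definition comm_subgroup (A B : G -> Prop) : G -> Prop :=
  gen (fun z => exists a b, [/\ A a, B b & z = commg a b]).

Fixpoint lcs_aux (K : G -> Prop) (n : nat) : G -> Prop :=
  match n with 0 => K | S m => comm_subgroup K (lcs_aux K m) end.
(* gamma_i(K), 1-indexed: gamma_1(K) = K, gamma_{i+1}(K) = [K, gamma_i(K)] *)
Definition gamma (K : G -> Prop) (i : nat) : G -> Prop := lcs_aux K i.-1.

Definition isolator (K L : G -> Prop) : G -> Prop :=
  fun x => K x /\ exists m, (0 < m)%N /\ L (gpow x m).

Definition Nser (i : nat) : G -> Prop := isolator full (gamma full i).
Definition Hser (H : G -> Prop) (i : nat) : G -> Prop := isolator H (gamma H i).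

Definition finitely_generated : Prop :=
  exists s : seq G, forall x, gen (fun y => exists2 i, (i < size s)%N & y = nth one s i) x.
Definition torsion_free : Prop :=
  forall x n, (0 < n)%N -> gpow x n = one -> x = one.
Definition nilpotent_class (c : nat) : Prop :=
  (forall x, gamma full c.+1 x -> x = one) /\
  (forall d, (d < c)%N -> ~ (forall x, gamma full d.+1 x -> x = one)).

Definition index_eq (H : G -> Prop) (n : nat) : Prop :=
  exists r : 'I_n -> G, forall x, exists! i, H ((r i)^-1 * x).

Definition hom_on (H : G -> Prop) (phi : G -> G) : Prop :=
  forall x y, H x -> H y -> phi (x * y) = phi x * phi y.

Definition combo (k : nat) (a : 'I_k -> G) (z : 'cV[int]_k) : G :=
  \big[@gmul G/one]_(j < k) zpow (a j) (z j ord0).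

(* the a_j (in N_i) have cosets forming a free basis of N_i/N_{i+1} *)
Definition malcev_level (i k : nat) (a : 'I_k -> G) : Prop :=
  (forall j, Nser i (a j)) /\
  (forall x, Nser i x -> exists! z : 'cV[int]_k, Nser i.+1 ((combo a z)^-1 * x)).

(* M is the matrix of phi_i : H_iN_{i+1}/N_{i+1} -> N_i/N_{i+1} in the
   coordinates given by the basis a *)
Definition induced_matrix (H : G -> Prop) (phi : G -> G) (i k : nat)
    (a : 'I_k -> G) (M : 'M[rat]_k) : Prop :=
  forall h (z w : 'cV[int]_k), Hser H i h ->
    Nser i.+1 ((combo a z)^-1 * h) ->
    Nser i.+1 ((combo a w)^-1 * phi h) ->
    map_mx (fun t : int => (t%:~R)%R : rat) w = (M *m map_mx (fun t : int => t%:~R) z)%R.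

Definition twisted (H : G -> Prop) (phi : G -> G) (x y : G) : Prop :=
  exists g, H g /\ x = g * (y * phi g^-1).

Definition n_classes (H : G -> Prop) (phi : G -> G) (n : nat) : Prop :=
  exists r : 'I_n -> G, forall x, exists! i, twisted H phi x (r i).

(* R(phi) = v, with v : option rat and None standing for infinity *)
Definition reidemeister_is (H : G -> Prop) (phi : G -> G) (v : option rat) : Prop :=
  match v with
  | Some q => exists m : nat, q = (m%:R)%R /\ n_classes H phi m
  | None => forall m, ~ n_classes H phi m
  end.
End GroupDefs.

(* |a|_oo : None stands for infinity *)
Definition abs_inf (q : rat) : option rat := if q == 0%R then None else Some `|q|%R.
(* n * v in Z_{>0} cup {oo} (n > 0) *)
Definition mul_inf (n : nat) (v : option rat) : option rat :=
  omap (fun q => (n%:R * q)%R) v.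

(* Main.v *)
Require Import Defs.
From mathcomp Require Import all_boot all_order all_algebra.
From Stdlib Require Import PropExtensionality FunctionalExtensionality ProofIrrelevance.
From Stdlib Require Import Classical ClassicalEpsilon.
Set Implicit Arguments. Unset Strict Implicit. Unset Printing Implicit Defensive.
Import Order.TTheory GRing.Theory Num.Theory.

(** Classes are counted modulo the isolators N_i, one level at a time.  If no
    det(I - M_l) with l < i vanishes, an element of H that fixes a twisted class
    modulo N_i lies in N_i.  Hence each class modulo N_i splits, modulo N_(i+1),
    into Z^(k_i) / (I - M_i) L_i classes, where L_i is the lattice of coordinates
    of the elements of H \cap N_i; there are [Z^(k_i) : L_i] |det(I - M_i)| of them,
    infinitely many if the determinant vanishes.  The trivial homomorphism, whose
    twisted classes are the right cosets of H, gives the product of the indices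
    [Z^(k_i) : L_i] as [N : H].

    That the N_i form a central series and that H_i = H \cap N_i both follow from one
    fact: if a nilpotent group is generated by elements having powers in a
    subgroup H, then every element of gamma_i has a power in gamma_i(H). *)

(* The ring and group libraries export another [commg]. *)
Local Notation commg := Defs.commg.

Declare Scope grp_scope.
Delimit Scope grp_scope with grp.
Notation "x * y" := (gmul x y) : grp_scope.
Notation "x ^-1" := (ginv x) : grp_scope.
Notation "1" := (gone _) : grp_scope.
Local Open Scope grp_scope.

(** * Group calculus from the one-sided axioms *)

Section GroupTheory.
Variable G : group.
Implicit Types (x y z g h : G) (K L S : G -> Prop).

Lemma gmulgV x : x * x^-1 = 1.
Proof.
by rewrite -[LHS]gmul1 -{1}(gmulV x^-1) -gmulA (gmulA x^-1) gmulV gmul1 gmulV.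
Qed.

Lemma gmulg1 x : x * 1 = x.
Proof. by rewrite -(gmulV x) gmulA gmulgV gmul1. Qed.

Lemma gmulKg x y : x^-1 * (x * y) = y.
Proof. by rewrite gmulA gmulV gmul1. Qed.

Lemma gmulVKg x y : x * (x^-1 * y) = y.
Proof. by rewrite gmulA gmulgV gmul1. Qed.

Lemma gmulI x y z : x * y = x * z -> y = z.
Proof. by move=> e; rewrite -(gmulKg x y) e gmulKg. Qed.

Lemma ginvK x : x^-1^-1 = x.
Proof. by apply: (@gmulI x^-1); rewrite gmulgV gmulV. Qed.

Lemma ginv1 : 1^-1 = 1 :> G.
Proof. by rewrite -[LHS]gmulg1 gmulV. Qed.

Lemma ginvM x y : (x * y)^-1 = y^-1 * x^-1.
Proof.
apply: (@gmulI (x * y)); rewrite gmulgV -gmulA (gmulA y) gmulgV gmul1.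
by rewrite gmulgV.
Qed.

Lemma gmulAr x y z : x * y * z = x * (y * z).
Proof. by rewrite gmulA. Qed.

End GroupTheory.

Definition gnormE (G : group) :=
  (@ginvM G, @ginvK G, @ginv1 G, @gmulAr G, @gmulg1 G, @gmul1 G,
   @gmulV G, @gmulgV G, @gmulKg G, @gmulVKg G).

Ltac gnorm := rewrite /commg ?gnormE.

(** * Powers, commuting elements and central commutators *)

Section Powers.
Variable G : group.
Implicit Types (x y z g h : G) (K L S : G -> Prop).

Definition gcomm x y := x * y = y * x.
Definition gcentral x := forall y, gcomm x y.

Lemma gcommP x y : gcomm x y <-> commg x y = 1.
Proof.
split=> [xy|]; first by rewrite /commg xy gmulKg gmulV.
move=> e; apply: (@gmulI _ y^-1); apply: (@gmulI _ x^-1); rewrite -/(commg x y) e.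
by gnorm.
Qed.

Lemma gcomm_mul x y z : gcomm x y -> gcomm x z -> gcomm x (y * z).
Proof. by rewrite /gcomm => xy xz; rewrite gmulA xy -gmulA xz gmulA. Qed.

Lemma gcomm_inv x y : gcomm x y -> gcomm x y^-1.
Proof.
move=> xy; apply: (@gmulI _ y); rewrite gmulA -xy; by gnorm.
Qed.

Lemma gcomm_sym x y : gcomm x y -> gcomm y x.
Proof. by []. Qed.

Lemma centralizer_subgroup x : is_subgroup (fun y => gcomm x y).
Proof.
split; first by rewrite /gcomm gmul1 gmulg1.
- by move=> y z; exact: gcomm_mul.
- by move=> y; exact: gcomm_inv.
Qed.

Lemma gpow1 x : gpow x 1 = x. Proof. exact: gmulg1. Qed.

Lemma gpow1n n : gpow 1 n = 1 :> G.
Proof. by elim: n => //= n ->; rewrite gmul1. Qed.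

Lemma gpowD x m n : gpow x (m + n) = gpow x m * gpow x n.
Proof. by elim: m => [|m IH] /=; rewrite ?gmul1 // IH gmulA. Qed.

Lemma gpowM x m n : gpow x (m * n) = gpow (gpow x m) n.
Proof. by elim: n => [|n IH] /=; rewrite ?muln0 // mulnS gpowD IH. Qed.

Lemma subg_pow K x n : is_subgroup K -> K x -> K (gpow x n).
Proof. by case=> K1 KM _ Kx; elim: n => //= n IH; exact: KM. Qed.

Lemma gpowMn x y n : gcomm x y -> gpow (x * y) n = gpow x n * gpow y n.
Proof.
move=> xy; elim: n => [|n IH] /=; first by rewrite gmul1.
have e : gcomm y (gpow x n) := subg_pow n (centralizer_subgroup y) (gcomm_sym xy).
by rewrite IH -!gmulA; congr gmul; rewrite !gmulA e.
Qed.

Lemma gpowV x n : gpow x^-1 n = (gpow x n)^-1.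
Proof.
apply: (@gmulI _ (gpow x n)); rewrite gmulgV -gpowMn; last by rewrite /gcomm gmulV gmulgV.
by rewrite gmulgV gpow1n.
Qed.

Lemma conj_pow x y n : gpow (y^-1 * (x * y)) n = y^-1 * (gpow x n * y).
Proof. by elim: n => [|n IH] /=; [gnorm | rewrite IH; gnorm]. Qed.

Lemma commgMl x y z : gcentral (commg x z) -> commg (x * y) z = commg x z * commg y z.
Proof.
move=> cxz; transitivity (y^-1 * (commg x z * y) * commg y z); first by gnorm.
by rewrite cxz gmulKg.
Qed.

Lemma commgMr x y z : gcentral (commg x y) -> commg x (y * z) = commg x z * commg x y.
Proof.
move=> cxy; transitivity (commg x z * (z^-1 * (commg x y * z))); first by gnorm.
by rewrite cxy gmulKg.
Qed.

(** The two exponents are treated one after the other: powers of a central commutator are central,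
    so [x^m, y] = [x, y]^m is central too and the rule for powers of y applies to x^m. *)
Lemma commg_pow x y m n :
  gcentral (commg x y) -> commg (gpow x m) (gpow y n) = gpow (commg x y) (m * n).
Proof.
have cent k u : gcentral u -> gcentral (gpow u k).
  move=> cu g; apply: gcomm_sym; apply: subg_pow (centralizer_subgroup g) _.
  exact: gcomm_sym.
have powr u k : gcentral (commg u y) -> commg u (gpow y k) = gpow (commg u y) k.
  move=> cu; elim: k => [|k IH]; first by rewrite /=; gnorm.
  by rewrite /= commgMr // IH; symmetry; exact: (cu (gpow (commg u y) k)).
move=> cxy; suff e : commg (gpow x m) y = gpow (commg x y) m.
  by rewrite powr e ?gpowM //; exact: cent.
elim: m => [|m IH]; first by rewrite /=; gnorm.
by rewrite /= commgMl // IH.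
Qed.

Lemma commg_centralr x y z : gcentral z -> commg x (y * z) = commg x y.
Proof.
move=> cz; transitivity (x^-1 * (z^-1 * (y^-1 * (x * y) * z))); first by gnorm.
by rewrite -cz gmulKg.
Qed.

End Powers.

(** * Homomorphisms *)

Definition gmorph (G G' : group) (f : G -> G') := forall x y, f (x * y) = f x * f y.

Section Morphisms.
Variables (G G' : group) (f : G -> G').
Hypothesis fM : gmorph f.

Lemma gmorph1 : f 1 = 1.
Proof. by apply: (@gmulI _ (f 1)); rewrite -fM !gmulg1. Qed.

Lemma gmorphV x : f x^-1 = (f x)^-1.
Proof. by apply: (@gmulI _ (f x)); rewrite -fM !gmulgV gmorph1. Qed.

Lemma gmorphX x n : f (gpow x n) = gpow (f x) n.
Proof. by elim: n => [|n IH] /=; rewrite ?gmorph1 // fM IH. Qed.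

Lemma gmorphR x y : f (commg x y) = commg (f x) (f y).
Proof. by rewrite /commg !fM !gmorphV. Qed.

Lemma preim_subgroup (K : G' -> Prop) : is_subgroup K -> is_subgroup (fun x => K (f x)).
Proof.
case=> K1 KM KV; split; first by rewrite gmorph1.
- by move=> x y Kx Ky; rewrite fM; exact: KM.
- by move=> x Kx; rewrite gmorphV; exact: KV.
Qed.

Lemma im_subgroup (K : G -> Prop) :
  is_subgroup K -> is_subgroup (fun y => exists2 x, K x & y = f x).
Proof.
case=> K1 KM KV; split; first by exists 1; rewrite ?gmorph1.
- by move=> _ _ [x Kx ->] [y Ky ->]; exists (x * y); rewrite ?fM //; exact: KM.
- by move=> _ [x Kx ->]; exists x^-1; rewrite ?gmorphV //; exact: KV.
Qed.
End Morphisms.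

(** * Subgroups and quotient groups *)

Section Subgroups.
Variable G : group.
Implicit Types (x y z g h : G) (K L S : G -> Prop).

Definition gnormal K := is_subgroup K /\ forall x g, K x -> K (g^-1 * (x * g)).

(** Any epimorphism with kernel K serves as the quotient, so no later argument looks inside a
    construction of G/K. *)
Definition quotient_map (Q : group) (f : G -> Q) K :=
  [/\ gmorph f, forall x, f x = 1 <-> K x & forall q, exists x, q = f x].

Lemma quotient_central (Q : group) (f : G -> Q) K x :
  quotient_map f K -> (forall g, K (commg g x)) -> gcentral (f x).
Proof.
move=> [fM fK fS] Kx q; have [g ->] := fS q.
by apply/gcomm_sym/gcommP; rewrite -(gmorphR fM); exact/fK.
Qed.

Lemma full_subgroup : is_subgroup (@full G).
Proof. by []. Qed.

Lemma gen_subgroup S : is_subgroup (gen S).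
Proof.
split=> [K [] // | x y Sx Sy K sK SK | x Sx K sK SK]; case: (sK) => _ KM KV.
  by apply: KM; [exact: Sx | exact: Sy].
by apply: KV; exact: Sx.
Qed.

Lemma gen_mem S x : S x -> gen S x.
Proof. by move=> Sx K _; apply. Qed.

Lemma sig_eq (T : Type) (P : T -> Prop) (u v : {x | P x}) : sval u = sval v -> u = v.
Proof. by case: u v => [u Pu] [v Pv] /= e; subst v; congr exist; exact: proof_irrelevance. Qed.

(** Makes results about a whole group available for a subgroup, seen through its inclusion map. *)
Lemma subgroup_as_group K : is_subgroup K ->
  exists (G' : group) (f : G' -> G),
    [/\ gmorph f, injective f & forall x, K x <-> exists u, x = f u].
Proof.
case=> K1 KM KV; pose T := {x | K x}.
pose m (u v : T) : T := exist _ (sval u * sval v) (KM _ _ (svalP u) (svalP v)).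
pose i (u : T) : T := exist _ (sval u)^-1 (KV _ (svalP u)).
have mA (x y z : T) : m x (m y z) = m (m x y) z by apply: sig_eq; exact: gmulA.
have m1 (x : T) : m (exist _ 1 K1) x = x by apply: sig_eq; exact: gmul1.
have mV (x : T) : m (i x) x = exist _ 1 K1 by apply: sig_eq; exact: gmulV.
exists (@Defs.Group T m i _ mA m1 mV), (fun u : T => sval u); split=> //.
  by move=> u v; exact: sig_eq.
by move=> x; split=> [Kx | [[u Ku] ->]] //; exists (exist _ x Kx).
Qed.

(** The carrier consists of the cosets as predicates, equal by extensionality. Products and inverses
    are computed on chosen representatives; normality makes the product independent of the
    choice. *)
Lemma quotient_exists K : gnormal K ->
  exists (Q : group) (f : G -> Q), quotient_map f K.
Proof.
case=> -[K1 KM KV] KJ.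
pose T := {P : G -> Prop | exists x, P = fun y => K (x^-1 * y)}.
pose cl x : T := exist _ (fun y => K (x^-1 * y)) (ex_intro _ x erefl).
have clE x y : K (x^-1 * y) -> cl x = cl y.
  move=> Kxy; apply: sig_eq; apply: functional_extensionality => z /=.
  apply: propositional_extensionality; split=> Kz.
    by have := KM _ _ (KV _ Kxy) Kz; gnorm.
  by have := KM _ _ Kxy Kz; gnorm.
have clP x y : cl x = cl y -> K (x^-1 * y).
  by move=> /(congr1 (fun u : T => sval u y)) /= ->; rewrite gmulV.
have rP (u : T) : exists x, u = cl x.
  by case: u => P [x e]; exists x; apply: sig_eq.
pose r u := sval (constructive_indefinite_description _ (rP u)).
have rK u : cl (r u) = u by rewrite /r; case: constructive_indefinite_description.
have clM x x' y y' : cl x = cl x' -> cl y = cl y' -> cl (x * y) = cl (x' * y').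
  move=> /clP Kx /clP Ky; apply: clE.
  by have := KM _ _ (KJ _ y Kx) Ky; gnorm.
pose m u v := cl (r u * r v); pose i u := cl (r u)^-1.
have mA (x y z : T) : m x (m y z) = m (m x y) z.
  rewrite /m; transitivity (cl (r x * (r y * r z))); first by apply: clM; rewrite ?rK.
  by rewrite gmulA; apply: clM; rewrite ?rK.
have m1 (x : T) : m (cl 1) x = x.
  by rewrite -[RHS]rK -[in RHS](gmul1 (r x)); apply: clM; rewrite ?rK.
have mV (x : T) : m (i x) x = cl 1.
  by rewrite -(gmulV (r x)); apply: clM; rewrite ?rK.
exists (@Defs.Group T m i _ mA m1 mV), cl; split; [by move=> x y; apply: clM; rewrite rK | | exact: rP].
move=> x; split=> [/clP /KV | Kx].
  by gnorm.
by apply/esym/clE; gnorm.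
Qed.

End Subgroups.

(** * Powers in the lower central series *)

Section LowerCentralSeries.
Variable G : group.
Implicit Types (x y z g h : G) (K L S : G -> Prop).

Lemma lcs_subgroup K n : is_subgroup K -> is_subgroup (lcs_aux K n).
Proof. by case: n => //= n _; exact: gen_subgroup. Qed.

Lemma lcs_commg K n a b : K a -> lcs_aux K n b -> lcs_aux K n.+1 (commg a b).
Proof. by move=> Ka Kb; apply: gen_mem; exists a, b. Qed.

Lemma lcs_conj K n x g : is_subgroup K ->
  K g -> lcs_aux K n x -> lcs_aux K n (g^-1 * (x * g)).
Proof.
move=> sK Kg; case: (sK) => K1 KM KV.
have KJ z : K z -> K (g^-1 * (z * g)).
  by move=> Kz; apply: (KM); [exact: KV | exact: KM].
elim: n x => [|n IH] x; first by move=> /= Kx; apply: KJ.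
move=> Kx; pose P y := lcs_aux K n.+1 (g^-1 * (y * g)).
have [L1 LM LV] := lcs_subgroup n.+1 sK.
apply: (Kx P).
  split; rewrite /P; first by move: L1; gnorm.
  - by move=> y z Py Pz; have := LM _ _ Py Pz; gnorm.
  - by move=> y Py; have := LV _ Py; gnorm.
move=> _ [a [b [Ka Kb ->]]]; rewrite /P.
have -> : g^-1 * (commg a b * g) = commg (g^-1 * (a * g)) (g^-1 * (b * g)) by gnorm.
by apply: lcs_commg; [exact: KJ | exact: IH].
Qed.

Lemma lcs_decS K n x : is_subgroup K -> lcs_aux K n.+1 x -> lcs_aux K n x.
Proof.
move=> sK Kx; have sL := lcs_subgroup n sK; apply: Kx => // _ [a [b [Ka Kb ->]]].
case: sL => _ LM LV.
have -> : commg a b = a^-1 * (b^-1 * a) * b by gnorm.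
by apply: (LM _ _ _ Kb); apply: lcs_conj => //; exact: LV.
Qed.

Lemma lcs_dec K m n x : is_subgroup K -> (m <= n)%N -> lcs_aux K n x -> lcs_aux K m x.
Proof.
move=> sK; elim: n => [|n IH]; first by rewrite leqn0 => /eqP ->.
by rewrite leq_eqVlt => /orP[/eqP -> // | mn /lcs_decS Kx]; exact: IH (Kx sK).
Qed.

Lemma lcs_full_normal n : gnormal (lcs_aux (@full G) n).
Proof. by split=> [|x g]; [exact: lcs_subgroup | exact: lcs_conj]. Qed.

Lemma lcs_central n (Q : group) (f : G -> Q) :
  quotient_map f (lcs_aux (@full G) n.+1) ->
  forall x, lcs_aux (@full G) n x -> gcentral (f x).
Proof. by move=> fQ x Lx; apply: quotient_central fQ _ => g; exact: lcs_commg. Qed.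
End LowerCentralSeries.

Lemma lcs_morph (G G' : group) (f : G -> G') (A : G -> Prop) (B : G' -> Prop) n x :
  gmorph f -> is_subgroup B -> (forall y, A y -> B (f y)) ->
  lcs_aux A n x -> lcs_aux B n (f x).
Proof.
move=> fM sB AB; elim: n x => [|n IH] x; first exact: AB.
move=> Ax; apply: (Ax (fun y => lcs_aux B n.+1 (f y))).
  by apply: preim_subgroup => //; exact: lcs_subgroup.
move=> _ [a [b [Aa Ab ->]]]; rewrite (gmorphR fM).
by apply: lcs_commg; [exact: AB | exact: IH].
Qed.

Section PowersInLowerCentralSeries.
Variables (G : group) (X H : G -> Prop).
Hypothesis genX : forall x, gen X x.
Hypothesis sH : is_subgroup H.
Hypothesis powX : forall x, X x -> exists2 m, (0 < m)%N & H (gpow x m).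

(** For a quotient map [f], this says that u has a positive power in A modulo the kernel. *)
Let pw (Q : group) (f : G -> Q) (A : G -> Prop) u :=
  exists m s, [/\ (0 < m)%N, A s & gpow (f u) m = f s].

Lemma pw_mul (Q : group) (f : G -> Q) (A : G -> Prop) u v :
  gmorph f -> is_subgroup A -> gcomm (f u) (f v) ->
  pw f A u -> pw f A v -> pw f A (u * v).
Proof.
move=> fM sA uv [m [s [m0 As e]]] [n [t [n0 At e']]].
exists (m * n)%N, (gpow s n * gpow t m); split; first by rewrite muln_gt0 m0.
  by case: (sA) => _ AM _; apply: AM; apply: subg_pow.
by rewrite fM gpowMn // fM gpowM e mulnC gpowM e' !(gmorphX fM).
Qed.

Lemma pw_inv (Q : group) (f : G -> Q) (A : G -> Prop) u :
  gmorph f -> is_subgroup A -> pw f A u -> pw f A u^-1.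
Proof.
move=> fM [_ _ AV] [m [s [m0 As e]]]; exists m, s^-1; split=> //; first exact: AV.
by rewrite !(gmorphV fM) gpowV e.
Qed.

Lemma pw_one (Q : group) (f : G -> Q) (A : G -> Prop) :
  gmorph f -> is_subgroup A -> pw f A 1.
Proof. by move=> fM [A1 _ _]; exists 1%N, 1; rewrite gpow1. Qed.

(** Each term of the lower central series is central modulo the next one, so its elements that have,
    modulo the next term, a power in the corresponding term for H form a subgroup. Hence only
    generators need checking: elements of X at the first level, commutators [a, b] afterwards. *)
Lemma lcs_power_step i u : lcs_aux (@full G) i u ->
  exists m s v, [/\ (0 < m)%N, lcs_aux H i s, lcs_aux (@full G) i.+1 v & gpow u m = s * v].
Proof.
have sF j : is_subgroup (lcs_aux (@full G) j) by exact: lcs_subgroup.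
have lift (Q : group) (f : G -> Q) j v : quotient_map f (lcs_aux (@full G) j.+1) ->
    pw f (lcs_aux H j) v -> exists m s w,
    [/\ (0 < m)%N, lcs_aux H j s, lcs_aux (@full G) j.+1 w & gpow v m = s * w].
  move=> [fM fK _] [m [s [m0 Hs e]]].
  exists m, s, (s^-1 * gpow v m); split=> //; last by rewrite gmulVKg.
  by apply/fK; rewrite fM (gmorphV fM) (gmorphX fM) e gmulV.
elim: i u => [|i IH] u Lu.
  have [Q [f fQ]] := quotient_exists (lcs_full_normal G 1).
  have [fM fK fS] := fQ; apply: (lift _ f) => //.
  apply: (genX u (K := pw f H)); last first.
    by move=> x /powX [m m0 Hx]; exists m, (gpow x m); split; rewrite // (gmorphX fM).
  split; first exact: pw_one.
  - by move=> x y; apply: pw_mul => //; exact: (lcs_central fQ).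
  - by move=> x; exact: pw_inv.
have [Q [f fQ]] := quotient_exists (lcs_full_normal G i.+2).
have [fM fK fS] := fQ; apply: (lift _ f) => //.
have sHi := lcs_subgroup i.+1 sH.
have cen := lcs_central fQ.
have [F1 FM FV] := sF i.+1.
suff [] : lcs_aux (@full G) i.+1 u /\ pw f (lcs_aux H i.+1) u by [].
apply: (Lu (fun v => lcs_aux (@full G) i.+1 v /\ pw f (lcs_aux H i.+1) v)).
  split; first by split=> //; exact: pw_one.
  - move=> x y [Lx Px] [Ly Py]; split; first exact: FM.
    by apply: pw_mul => //; exact: cen.
  - by move=> x [Lx Px]; split; [exact: FV | exact: pw_inv].
move=> _ [a [b [_ Lb ->]]]; split; first exact: lcs_commg.
have cc x : gcentral (f (commg x b)) by apply: cen; exact: lcs_commg.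
(* Modulo the next term [a, b] is multiplicative in a, so a may be taken in X. *)
apply: (genX a (K := fun a => pw f (lcs_aux H i.+1) (commg a b))).
  have fMl x y : f (commg (x * y) b) = f (commg x b * commg y b).
    by rewrite fM !(gmorphR fM) fM commgMl // -gmorphR.
  have pwE x y : f x = f y -> pw f (lcs_aux H i.+1) x -> pw f (lcs_aux H i.+1) y.
    by move=> e; rewrite /pw e.
  have c1 : commg 1 b = 1 by gnorm.
  split; first by rewrite c1; exact: pw_one.
  - move=> x y Px Py; apply: (pwE (commg x b * commg y b)); first by rewrite fMl.
    by apply: pw_mul => //; exact: cc.
  - move=> x Px; apply: (pwE (commg x b)^-1); last exact: pw_inv.
    apply: (@gmulI _ (f (commg x b))).
    by rewrite -!fM -fMl !gmulgV c1.
move=> x /powX [m m0 Hx]; have [n [s [w [n0 Hs Lw e]]]] := IH _ Lb.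
(* With b^n = s w and w central modulo the next term, [x, b]^(mn) = [x^m, b^n] = [x^m, s]. *)
exists (m * n)%N, (commg (gpow x m) s); split; first by rewrite muln_gt0 m0.
  exact: lcs_commg.
rewrite (gmorphR fM) -commg_pow; last by rewrite -(gmorphR fM); exact: cc.
by rewrite -!(gmorphX fM) e (gmorphR fM) fM commg_centralr //; exact: cen.
Qed.

(** Repeated use of [lcs_power_step] on the error factor pushes it down the series until nilpotency
    kills it. *)
Lemma lcs_power c i y : (forall x, lcs_aux (@full G) c x -> x = 1) ->
  lcs_aux (@full G) i y -> exists2 m, (0 < m)%N & lcs_aux H i (gpow y m).
Proof.
move=> nilG Ly.
suff [m [s [v [m0 Hs Lv e]]]] : exists m s v, [/\ (0 < m)%N, lcs_aux H i s,
    lcs_aux (@full G) (i + c).+1 v & gpow y m = s * v].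
  exists m => //; rewrite e (nilG v) ?gmulg1 //.
  by apply: lcs_dec Lv => //; rewrite leqW // leq_addl.
elim: c {nilG} => [|d [m [s [v [m0 Hs Lv e]]]]].
  by rewrite addn0; exact: lcs_power_step.
have [n [t [w [n0 Ht Lw e']]]] := lcs_power_step Lv.
have [Q [f fQ]] := quotient_exists (lcs_full_normal G (i + d).+2).
have [fM fK _] := fQ; rewrite addnS.
have sHi := lcs_subgroup i sH.
(* Here y^m = s v and v^n = t w. As v is central modulo the next term, y^(mn) = s^n v^n = s^n t w
   there, and w vanishes. *)
exists (m * n)%N, (gpow s n * t), ((gpow s n * t)^-1 * gpow y (m * n)).
split; first by rewrite muln_gt0 m0.
- case: (sHi) => _ HM _; apply: HM; first exact: subg_pow.
  by apply: lcs_dec Ht => //; rewrite -addnS leq_addr.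
- apply/fK; rewrite gpowM e fM (gmorphV fM) !fM !(gmorphX fM) fM gpowMn; last first.
    exact/gcomm_sym/(lcs_central fQ).
  by rewrite -(gmorphX fM v) e' fM (fK w).2 // gmulg1 gmulV.
- by rewrite gmulVKg.
Qed.
End PowersInLowerCentralSeries.

(** * Isolators in a nilpotent group *)

Section Nilpotent.
Variables (G : group) (c : nat).
Hypothesis nilG : forall x, lcs_aux (@full G) c x -> x = 1.
Implicit Types (x y z g h : G) (K L S X H : G -> Prop).

(** In [lcs_power] the set X generates the ambient group; here the subgroup generated by X is made
    into a group of its own, and the series are carried along the inclusion. *)
Lemma lcs_gen_power X H i y : is_subgroup H ->
  (forall x, X x -> exists2 m, (0 < m)%N & H (gpow x m)) ->
  lcs_aux (gen X) i y -> exists2 m, (0 < m)%N & lcs_aux H i (gpow y m).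
Proof.
move=> sH powX; have [G' [f [fM fI fK]]] := subgroup_as_group (gen_subgroup X).
have fG' u : gen X (f u) by apply/fK; exists u.
have genX' u : gen (fun v => X (f v)) u.
  move=> L sL XL; have [v Lv /fI ->] // : exists2 v, L v & f u = f v.
  apply: (fG' u _ (im_subgroup fM sL)) => x Xx.
  by have [v e] := (fK x).1 (gen_mem Xx); exists v => //; apply: XL; rewrite -e.
have sH' := preim_subgroup fM sH.
have powX' u : X (f u) -> exists2 m, (0 < m)%N & H (f (gpow u m)).
  by move=> /powX [m m0 Hm]; exists m; rewrite ?(gmorphX fM).
have nil' u : lcs_aux (@full G') c u -> u = 1.
  move=> Lu; apply: fI; rewrite (gmorph1 fM); apply: nilG.
  exact: (lcs_morph fM (full_subgroup G) _ Lu).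
have lift j x : lcs_aux (gen X) j x -> exists2 u, lcs_aux (@full G') j u & x = f u.
  elim: j x => [|j IH] x Lx; first by have [u ->] := (fK x).1 Lx; exists u.
  apply: (Lx (fun x => exists2 u, lcs_aux (@full G') j.+1 u & x = f u)).
    by apply: im_subgroup => //; exact: lcs_subgroup.
  move=> _ [a [b [/fK [a' ->] /IH [b' Lb ->] ->]]].
  by exists (commg a' b'); [exact: lcs_commg | rewrite (gmorphR fM)].
move=> /lift [u Lu ->]; have [m m0 Lm] := lcs_power genX' sH' powX' nil' Lu.
by exists m => //; rewrite -(gmorphX fM); exact: (lcs_morph fM sH _ Lm).
Qed.

(** For products: x and y have powers in S, hence so does every element of the subgroup they
    generate, by [lcs_gen_power] at level 0. *)
Lemma isolator_subgroup S : is_subgroup S -> is_subgroup (isolator (@full G) S).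
Proof.
move=> sS; case: (sS) => S1 SM SV; split.
- by split=> //; exists 1%N; rewrite gpow1.
- move=> x y [_ [m [m0 Sx]]] [_ [n [n0 Sy]]]; split=> //.
  have pw z : z = x \/ z = y -> exists2 k, (0 < k)%N & S (gpow z k).
    by case=> ->; [exists m | exists n].
  have [|k k0 Sk] := @lcs_gen_power _ S 0 (x * y) sS pw.
    case: (gen_subgroup (fun z => z = x \/ z = y)) => _ GM _.
    by apply: GM; apply: gen_mem; [left | right].
  by exists k.
- move=> x [_ [m [m0 Sx]]]; split=> //; exists m; split=> //.
  by rewrite gpowV; exact: SV.
Qed.

(* The commutator of g and y lies in gamma_2 of <g, y>, hence has a power in
   gamma_2 of <g, y^m>, which is trivial modulo gamma_(i+1). *)
Lemma isolator_lcs_commg i g y : isolator (@full G) (lcs_aux (@full G) i) y ->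
  isolator (@full G) (lcs_aux (@full G) i.+1) (commg g y).
Proof.
move=> [_ [m [m0 Ly]]]; split=> //.
pose X z := z = g \/ z = y; pose X' z := z = g \/ z = gpow y m.
have pw z : X z -> exists2 k, (0 < k)%N & gen X' (gpow z k).
  case=> ->; first by exists 1%N => //; rewrite gpow1; apply: gen_mem; left.
  by exists m => //; apply: gen_mem; right.
have Lgy : lcs_aux (gen X) 1 (commg g y).
  by apply: lcs_commg; apply: gen_mem; [left | right].
have [k k0 Lk] := lcs_gen_power (gen_subgroup X') pw Lgy.
exists k; split=> //; apply: Lk; first exact: lcs_subgroup.
move=> _ [a [b [Xa Xb ->]]].
have [Q [f fQ]] := quotient_exists (lcs_full_normal G i.+1).
have [fM fK _] := fQ; have cy := lcs_central fQ Ly.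
apply/fK; rewrite (gmorphR fM); apply/gcommP.
have ca z : X' z -> gcomm (f z) (f a).
  move=> X'z; apply: (Xa _ (preim_subgroup fM (centralizer_subgroup (f z)))) => w.
  by case: X'z => -> // [] -> //; exact/gcomm_sym/cy.
apply: (Xb _ (preim_subgroup fM (centralizer_subgroup (f a)))) => z /ca.
exact: gcomm_sym.
Qed.

Lemma isolator_lcs_normal i : gnormal (isolator (@full G) (lcs_aux (@full G) i)).
Proof.
split; first by apply: isolator_subgroup; exact: lcs_subgroup.
move=> x g [_ [m [m0 Lx]]]; split=> //; exists m; split=> //.
by rewrite conj_pow; exact: lcs_conj.
Qed.

End Nilpotent.

(** * Counting classes *)

Local Close Scope grp_scope.

(** Common form of [n_classes] and [index_eq]: both are instances of it. *)
Definition ncl (T : Type) (E : T -> T -> Prop) (n : nat) :=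
  exists r : 'I_n -> T, forall x, exists! i, E x (r i).

Definition equivalence (T : Type) (E : T -> T -> Prop) :=
  [/\ forall x, E x x, forall x y, E x y -> E y x &
      forall x y z, E x y -> E y z -> E x z].

Lemma ncl_fin (T : Type) (E : T -> T -> Prop) (I : finType) (r : I -> T) :
  (forall x, exists! i, E x (r i)) -> ncl E #|I|.
Proof.
move=> rP; exists (fun i => r (enum_val i)) => x; have [i [Ei ui]] := rP x.
exists (enum_rank i); split=> [|j /ui ->]; first by rewrite enum_rankK.
by rewrite enum_valK.
Qed.

Lemma ncl_ext (T : Type) (E E' : T -> T -> Prop) n :
  (forall x y, E x y <-> E' x y) -> ncl E n -> ncl E' n.
Proof.
move=> EE [r rP]; exists r => x; have [i [Ei ui]] := rP x.
by exists i; split=> [|j /EE]; [exact/EE | exact: ui].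
Qed.

Lemma ncl_pigeonhole (T : Type) (E : T -> T -> Prop) n (I : finType) (f : I -> T) :
  equivalence E -> ncl E n -> (n < #|I|)%N -> exists i j, i <> j /\ E (f i) (f j).
Proof.
move=> [_ Es Et] [r rP] ltn.
have /fin_all_exists [g gP] i : exists k, E (f i) (r k).
  by have [k [Ek _]] := rP (f i); exists k.
have /injectivePn [i [j ij e]] : ~~ injectiveb g.
  apply/negP => /injectiveP /leq_card; rewrite card_ord leqNgt.
  by rewrite ltn.
exists i, j; split; first exact/eqP.
by apply: Et (gP i) _; rewrite e; exact: Es.
Qed.

Lemma ncl_unique (T : Type) (E : T -> T -> Prop) m n :
  equivalence E -> ncl E m -> ncl E n -> m = n.
Proof.
move=> eE; wlog lt : m n / (m < n)%N.
  by move=> H Em En; case: (ltngtP m n) => // lt; [exact: H | apply/esym; exact: H].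
move=> Em [r rP]; rewrite -[n]card_ord in lt.
have [i [j [ij Eij]]] := ncl_pigeonhole r eE Em lt.
have [l [_ ul]] := rP (r i).
by case: ij; rewrite -(ul i) ?(ul j) //; case: eE => ? _ _.
Qed.

(* [s y] parametrizes, up to [F], the [E]-class of [y] by the [E']-classes. *)
Lemma ncl_fibration (T T' : Type) (E F : T -> T -> Prop) (E' : T' -> T' -> Prop)
    (s : T -> T' -> T) p q :
  equivalence E -> equivalence F -> equivalence E' ->
  (forall x y, F x y -> E x y) -> (forall y u, E (s y u) y) ->
  (forall x y, E x y -> exists u, F x (s y u)) ->
  (forall y u v, F (s y u) (s y v) <-> E' u v) ->
  ncl E p -> ncl E' q -> ncl F (p * q).
Proof.
move=> [_ _ Et] [_ Fs Ft] [_ E's E't] FE sE sF sE' [r rP] [r' rP'].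
rewrite -[p]card_ord -[q]card_ord -card_prod.
apply: (@ncl_fin _ _ _ (fun ij => s (r ij.1) (r' ij.2))) => x.
have [i [Ei ui]] := rP x; have [u Fu] := sF _ _ Ei; have [j [Ej uj]] := rP' u.
exists (i, j); split=> [|[i' j'] /= F'] /=; first by apply: Ft Fu _; exact/sE'.
have e : i = i' by apply: ui; apply: Et (FE _ _ F') (sE _ _).
congr pair => //; apply: uj; apply/(sE' (r i)); apply: Ft (Fs _ _ Fu) _.
by rewrite e.
Qed.

(** * Sublattices of Z^k and their indices *)

Section Lattices.
Local Open Scope ring_scope.

Definition lattice k (D : 'cV[int]_k -> Prop) :=
  D 0 /\ forall z w, D z -> D w -> D (z - w).

Lemma lattice_opp k (D : 'cV[int]_k -> Prop) z : lattice D -> D z -> D (- z).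
Proof. by case=> D0 DB Dz; rewrite -sub0r; exact: DB. Qed.

Lemma lattice_add k (D : 'cV[int]_k -> Prop) z w : lattice D -> D z -> D w -> D (z + w).
Proof. by move=> lD Dz Dw; rewrite -[w]opprK; apply: lD.2 => //; exact: lattice_opp. Qed.

Lemma lattice_scale k (D : 'cV[int]_k -> Prop) z (a : int) : lattice D -> D z -> D (a *: z).
Proof.
move=> lD Dz; have nat_case (n : nat) : D (n%:Z *: z).
  elim: n => [|n IH]; first by rewrite scale0r; exact: lD.1.
  by rewrite intS scalerDl scale1r; exact: lattice_add.
case: a => n; first exact: nat_case.
by rewrite NegzE scaleNr; apply: lattice_opp.
Qed.

Lemma lattice_equivalence k (D : 'cV[int]_k -> Prop) :
  lattice D -> equivalence (fun z w => D (z - w)).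
Proof.
move=> lD; split=> [z | z w Dzw | z w v Dzw Dwv]; first by rewrite subrr; exact: lD.1.
  by rewrite -opprB; exact: lattice_opp.
by rewrite -(subrKA w); exact: lattice_add.
Qed.

(** The generator is the least positive element, which exists because of m; division with remainder
    by it does the rest. As P need not be decidable, the least element is found by strong induction
    and excluded middle. *)
Lemma int_subgroup_principal (P : int -> Prop) (m : int) :
  P 0 -> (forall z w, P z -> P w -> P (z - w)) -> P m -> m != 0 ->
  exists d : nat, [/\ (0 < d)%N, P d%:Z & forall z, P z <-> (d %| z)%Z].
Proof.
move=> P0 PB Pm m0.
have PN z : P z -> P (- z) by move=> Pz; rewrite -sub0r; exact: PB.
have PD z w : P z -> P w -> P (z + w).
  by move=> Pz Pw; rewrite -[w]opprK; apply: PB => //; exact: PN.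
have [d [d0 Pd dmin]] : exists d : nat, [/\ (0 < d)%N, P d%:Z &
    forall e : nat, (0 < e)%N -> P e%:Z -> (d <= e)%N].
  have : exists e : nat, (0 < e)%N /\ P e%:Z.
    exists `|m|%N; split; first by rewrite absz_gt0.
    by rewrite abszE; case: (ger0P m) => _ //; exact: PN.
  case=> e; elim/ltn_ind: e => e IH [e0 Pe].
  have [[e' [lt e'0 Pe']] | no] :=
    classic (exists e' : nat, [/\ (e' < e)%N, (0 < e')%N & P e'%:Z]); first exact: (IH e').
  exists e; split=> // e' e'0 Pe'; rewrite leqNgt; apply/negP => lt.
  by apply: no; exists e'.
have PMn z (n : nat) : P z -> P (z * n%:Z).
  by move=> Pz; elim: n => [|n IH]; rewrite ?mulr0 // intS mulrDr mulr1; exact: PD.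
have PM z w : P z -> P (z * w).
  move=> Pz; case: w => n; first exact: PMn.
  by rewrite NegzE mulrN; apply: PN; exact: PMn.
exists d; split=> // z; split=> [Pz | /dvdzP [q ->]]; last by rewrite mulrC; exact: PM.
apply/dvdz_mod0P/eqP/negPn/negP => r0.
have d0' : d%:Z != 0 by rewrite -lt0n.
have r_ge : 0 <= (z %% d%:Z)%Z by exact: modz_ge0.
have Pr : P (z %% d%:Z)%Z.
  have -> : (z %% d%:Z)%Z = z - d%:Z * (z %/ d%:Z)%Z.
    by rewrite {2}(divz_eq z d%:Z) mulrC addrAC subrr add0r.
  by apply: PB => //; exact: PM.
have lt : (z %% d%:Z)%Z < d%:Z by exact: ltz_pmod.
case: (z %% d%:Z)%Z r0 r_ge Pr lt => // r r0 _ Pr lt.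
by have := dmin r; rewrite lt0n r0 leqNgt (_ : (r < d)%N) // => /(_ isT Pr).
Qed.

(* A basis is built in Hermite (triangular) form, which makes the index visible. *)
Lemma lattice_basis k (D : 'cV[int]_k -> Prop) (m : int) :
  lattice D -> m != 0 -> (forall z, D (m *: z)) ->
  exists B : 'M[int]_k, [/\ \det B != 0, forall z, D z <-> exists w, z = B *m w &
    ncl (fun z w => D (z - w)) `|\det B|%N].
Proof.
elim: k D => [|k IH]; last rewrite -[k.+1]/(1 + k)%N; move=> D lD m0 Dm.
  exists 1%:M; split; first by rewrite det1.
    move=> z; split=> _; first by exists z; rewrite mul1mx.
    by rewrite (flatmx0 z); exact: lD.1.
  have -> : `|\det (1%:M : 'M[int]_0)|%N = 1%N by rewrite det1.
  exists (fun _ => 0) => z; exists ord0; split=> [|j _]; last by rewrite [j]ord1.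
  by rewrite (flatmx0 (z - 0)); exact: lD.1.
pose emb (u : 'cV[int]_k) : 'cV[int]_(1 + k) := col_mx 0 u.
have embB u v : emb (u - v) = emb u - emb v.
  by rewrite /emb opp_col_mx add_col_mx subr0.
pose D' u := D (emb u).
have lD' : lattice D'.
  split; first by rewrite /D' /emb col_mx0; exact: lD.1.
  by move=> u v Du Dv; rewrite /D' embB; exact: lD.2.
have Dm' u : D' (m *: u).
  by rewrite /D' /emb -[0](scaler0 _ m) -scale_col_mx; exact: Dm.
have [B' [B'0 B'D B'n]] := IH _ lD' m0 Dm'.
pose hd (z : 'cV[int]_(1 + k)) := usubmx z 0 0.
have hdB z w : hd (z - w) = hd z - hd w by rewrite /hd !mxE.
have hdZ q z : hd (q *: z) = q * hd z by rewrite /hd !mxE.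
have hd_emb u : hd (emb u) = 0 by rewrite /hd col_mxKu mxE.
have hd0 z : hd z = 0 -> z = emb (dsubmx z).
  move=> e; rewrite -[LHS]vsubmxK /emb; congr col_mx.
  by apply/matrixP=> i j; rewrite !ord1 [RHS]mxE.
(* The first coordinates of elements of D form a subgroup dZ. An element z0 of D with first
   coordinate d completes a basis of the sublattice where that coordinate vanishes. *)
have [] := @int_subgroup_principal (fun x => exists2 z, D z & hd z = x) m _ _ _ m0.
- by exists 0; [exact: lD.1 | rewrite /hd !mxE].
- by move=> _ _ [z Dz <-] [w Dw <-]; exists (z - w); [exact: lD.2 | exact: hdB].
- by exists (m *: const_mx 1); [exact: Dm | rewrite hdZ /hd !mxE mulr1].
move=> d [d0 [z0 Dz0 hz0] dP].
have Dhd (z : 'cV[int]_(1 + k)) : D z -> exists2 q : int, hd z = q * d%:Z & D' (dsubmx (z - q *: z0)) /\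
    z - q *: z0 = emb (dsubmx (z - q *: z0)).
  move=> Dz; have /dvdzP [q e] : (d %| hd z)%Z by apply/dP; exists z.
  have e' : z - q *: z0 = emb (dsubmx (z - q *: z0)).
    by apply: hd0; rewrite hdB hdZ hz0 e subrr.
  exists q => //; split=> //; rewrite /D' -e'; apply: lD.2 => //.
  exact: lattice_scale.
pose B : 'M[int]_(1 + k) := row_mx z0 (col_mx 0 B').
have BE (w1 : 'M_1) w2 : B *m col_mx w1 w2 = w1 0 0 *: z0 + emb (B' *m w2).
  by rewrite mul_row_col {1}(mx11_scalar w1) mul_mx_scalar mul_col_mx mul0mx.
have detB : \det B = d%:Z * \det B'.
  rewrite /B -[z0]vsubmxK -block_mxEh det_lblock; congr (_ * _).
  by rewrite {1}[usubmx z0]mx11_scalar -/(hd z0) hz0 det_scalar1.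
exists B; split.
- by rewrite detB mulf_neq0 // -lt0n.
- move=> z; split=> [/Dhd [q _ [/B'D [w ew] e]] | [w ->]].
    by exists (col_mx q%:M w); rewrite BE mxE eqxx mulr1n -ew -e addrC subrK.
  rewrite -[w]vsubmxK BE; apply: lattice_add => //; first exact: lattice_scale.
  by apply/B'D; eexists.
rewrite detB abszM absz_nat.
(* Classes modulo D lie over the d residues of the first coordinate, and each fibre is a copy of the
   classes modulo D'. *)
apply: (@ncl_fibration _ _ (fun z w => (d%:Z %| hd z - hd w)%Z) _ _
  (fun y u => y + emb u) _ _ _ _ _ _ _ _ _ _ B'n).
- split=> [z | z w | z w v]; first by rewrite subrr dvdz0.
    by rewrite -opprB rpredN.
  by move=> zw wv; rewrite -(subrKA (hd w)); exact: rpredD.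
- exact: lattice_equivalence.
- exact: lattice_equivalence.
- by move=> z w Dzw; rewrite -hdB; apply/dP; exists (z - w).
- by move=> z u; rewrite -hdB addrAC subrr add0r hd_emb dvdz0.
- move=> z w /dvdzP [q e]; exists (dsubmx (z - w - q *: z0)).
  rewrite -hd0; last by rewrite !hdB hdZ hz0 -e subrr.
  by rewrite addrA (addrC w) subrK opprB addrC subrK; exact: lattice_scale.
- by move=> y u v; rewrite opprD addrACA subrr add0r -embB.
exists (fun i : 'I_d => col_mx (i : nat)%:Z%:M 0) => z.
have hdE (i : 'I_d) : hd (col_mx (i : nat)%:Z%:M 0) = i :> int.
  by rewrite /hd col_mxKu mxE.
have dz : d%:Z != 0 by rewrite -lt0n.
have lt : (`|(hd z %% d)%Z| < d)%N.
  by rewrite -ltz_nat gez0_abs ?modz_ge0 // ltz_pmod.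
exists (Ordinal lt); split=> [|j]; rewrite -eqz_mod_dvd hdE /=.
  by rewrite gez0_abs ?modz_ge0 // modz_mod.
move=> /eqP e; apply: val_inj => /=.
by rewrite e modz_nat absz_nat modn_small.
Qed.

(** The image of C also has the basis B from [lattice_basis], for which the index is known. Each of
    B and C is an integral right multiple of the other, so their determinants divide each other. *)
Lemma lattice_index k (C : 'M[int]_k) : \det C != 0 ->
  ncl (fun z w : 'cV[int]_k => exists v, z - w = C *m v) `|\det C|%N.
Proof.
move=> C0; pose D (z : 'cV[int]_k) := exists v, z = C *m v.
have lD : lattice D.
  split; first by exists 0; rewrite mulmx0.
  by move=> _ _ [z ->] [w ->]; exists (z - w); rewrite mulmxBr.
(* The adjugate shows that the image contains det(C) Z^k. *)
have Dm z : D (\det C *: z).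
  by exists (\adj C *m z); rewrite mulmxA mul_mx_adj mul_scalar_mx.
have [B [B0 BD Bn]] := lattice_basis lD C0 Dm.
suff -> : `|\det C|%N = `|\det B|%N by [].
have factor (A A' : 'M[int]_k) :
    (forall w : 'cV_k, exists v, A *m w = A' *m v) -> (`|\det A'| %| `|\det A|)%N.
  move=> AA'; have /fin_all_exists [u uP] j : exists v, A *m (delta_mx j 0 : 'cV_k) = A' *m v by exact: AA'.
  suff -> : A = A' *m (\matrix_(i, j) u j i 0) by rewrite det_mulmx abszM dvdn_mulr.
  apply/matrixP => i j; have /matrixP /(_ i 0) := uP j.
  by rewrite -colE !mxE => ->; apply: eq_bigr => l _; rewrite !mxE.
apply/eqP; rewrite eqn_dvd; apply/andP; split; apply: factor => w.
- by apply: ((BD (B *m w)).2 _); exists w.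
- by apply/BD; exists w.
Qed.
End Lattices.

(** * Twisted classes along a central filtration *)

Local Open Scope grp_scope.

Lemma quotient_eq (G Q : group) (f : G -> Q) (K : G -> Prop) x y :
  quotient_map f K -> f x = f y <-> K (y^-1 * x).
Proof.
case=> fM fK _; rewrite -fK fM (gmorphV fM); split=> [-> | e]; first exact: gmulV.
by apply: (@gmulI _ (f y)^-1); rewrite e gmulV.
Qed.

(** * Coordinates on a free abelian factor A/B *)

Section Coordinates.
Variables (G : group) (A B : G -> Prop) (k : nat) (co : G -> 'cV[int]_k).

(** [co] induces an isomorphism from A/B onto Z^k; outside A its values are arbitrary. *)
Definition coords :=
  [/\ forall x y, A x -> A y -> co (x * y) = (co x + co y)%R,
      forall x, A x -> co x = 0%R <-> B x &
      forall z, exists2 x, A x & co x = z].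

Hypotheses (sA : is_subgroup A) (coP : coords).

Lemma coords1 : co 1 = 0%R.
Proof.
case: coP sA => coM _ _ [A1 _ _]; apply: (@addrI _ (co 1)).
by rewrite -coM // gmul1 addr0.
Qed.

Lemma coordsV x : A x -> co x^-1 = (- co x)%R.
Proof.
case: coP sA => coM _ _ [_ _ AV] Ax; apply: (@addrI _ (co x)).
by rewrite -coM ?gmulgV ?coords1 ?subrr //; exact: AV.
Qed.

Lemma coords_eq (Q : group) (f : G -> Q) x y :
  quotient_map f B -> A x -> A y -> co x = co y <-> f x = f y.
Proof.
move=> fB Ax Ay; case: coP sA => coM coK _ [_ AM AV].
rewrite (quotient_eq x y fB) -coK; last by apply: AM => //; exact: AV.
rewrite coM ?coordsV //; last exact: AV.
rewrite addrC; split=> [-> | /eqP]; first by rewrite subrr.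
by rewrite subr_eq0 => /eqP.
Qed.

Lemma coordsX x n : A x -> co (gpow x n) = (n%:Z *: co x)%R.
Proof.
move=> Ax; elim: n => [|n IH]; first by rewrite coords1 scale0r.
case: coP => coM _ _; rewrite /= coM //; last exact: subg_pow.
by rewrite IH intS scalerDl scale1r.
Qed.
End Coordinates.

Lemma intr_mx_inj m n (A B : 'M[int]_(m, n)) :
  map_mx (intr : int -> rat) A = map_mx intr B -> A = B.
Proof.
by move=> /matrixP e; apply/matrixP => i j; have := e i j; rewrite !mxE => /intr_inj.
Qed.

Section Filtration.
Variables (G : group) (H : G -> Prop) (F : nat -> G -> Prop).

(* Twisted conjugacy modulo [F j]. *)
Definition tw (phi : G -> G) j x y :=
  exists2 g, H g & F j ((g * (y * phi g^-1))^-1 * x).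

(* The lattice (I - M_j) L_j. *)
Definition difflat (phi : G -> G) j k (co : G -> 'cV[int]_k) z :=
  exists h, [/\ H h, F j h & z = (co h - co (phi h))%R].

(** H acts on G modulo [F j] by sending y to g y phi(g)^-1; all point stabilizers of this action are
    required to lie in [F j]. *)
Definition stab (phi : G -> G) j :=
  forall y g, H g -> F j ((g * (y * phi g^-1))^-1 * y) -> F j g.

Definition level_matrix (phi : G -> G) j k (co : G -> 'cV[int]_k) (M : 'M[rat]_k) :=
  forall h, H h -> F j h ->
  map_mx (intr : int -> rat) (co (phi h)) = (M *m map_mx intr (co h))%R.

Hypothesis sH : is_subgroup H.
Hypothesis Fn : forall j, gnormal (F j).
Hypothesis FS : forall j x, F j.+1 x -> F j x.
Hypothesis FC : forall j g x, F j x -> F j.+1 (commg g x).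

Let sF j : is_subgroup (F j) := (Fn j).1.

Lemma filtration_central j (Q : group) (f : G -> Q) :
  quotient_map f (F j.+1) -> forall x, F j x -> gcentral (f x).
Proof. by move=> fQ x Fx; apply: quotient_central fQ _ => g; exact: FC. Qed.

Section Twisted.
Variable phi : G -> G.
Hypothesis homphi : hom_on H phi.
Hypothesis phiF : forall j h, H h -> F j h -> F j (phi h).

Lemma hom_on1 : phi 1 = 1.
Proof. by case: sH => H1 _ _; apply: (@gmulI _ (phi 1)); rewrite -homphi // !gmulg1. Qed.

Lemma hom_onV x : H x -> phi x^-1 = (phi x)^-1.
Proof.
move=> Hx; apply: (@gmulI _ (phi x)); rewrite -homphi //; last by case: sH => _ _; apply.
by rewrite !gmulgV hom_on1.
Qed.

Lemma twE (Q : group) (f : G -> Q) j x y : quotient_map f (F j) ->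
  tw phi j x y <-> exists2 g, H g & f x = f (g * (y * phi g^-1)).
Proof. by move=> fQ; split=> -[g Hg e]; exists g => //; exact/(quotient_eq _ _ fQ). Qed.

Lemma tw_equivalence j : equivalence (tw phi j).
Proof.
have [Q [f fQ]] := quotient_exists (Fn j); have E := twE _ _ fQ.
case: (fQ) (sH) => fM _ _ [H1 HM HV]; split.
- by move=> x; apply/E; exists 1 => //; rewrite ginv1 hom_on1 gmulg1 gmul1.
- move=> x y /E [g Hg e]; apply/E; exists g^-1; first exact: HV.
  by rewrite fM (fM x) e -!fM !hom_onV; first (by gnorm); do ?exact: HV.
- move=> x y z /E [g Hg e] /E [h Hh e']; apply/E; exists (g * h); first exact: HM.
  rewrite e fM (fM y) e' -!fM ginvM homphi; [by gnorm | exact: HV | exact: HV].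
Qed.

Lemma twS j x y : tw phi j.+1 x y -> tw phi j x y.
Proof. by case=> g Hg /FS e; exists g. Qed.

Lemma difflat_lattice j k (co : G -> 'cV[int]_k) :
  coords (F j) (F j.+1) co -> lattice (difflat phi j co).
Proof.
move=> coP; case: (sH) (sF j) => H1 HM HV [F1 FM FV]; split.
  by exists 1; split=> //; rewrite hom_on1 subrr.
move=> _ _ [g [Hg Fg ->]] [h [Hh Fh ->]].
have [Hh' Fh'] := (HV _ Hh, FV _ Fh).
exists (g * h^-1); split; [exact: HM | exact: FM |].
have := phiF Hg Fg; have := phiF Hh Fh => Fph Fpg; have Fph' := FV _ Fph.
case: (coP) => coM _ _; rewrite homphi // hom_onV // !coM // !(coordsV (sF j) coP) //.
by rewrite !opprD !opprK addrACA.
Qed.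

(** Modulo [F j.+1] the element g is central, so g (y v) phi(g)^-1 equals y (g v phi(g)^-1);
    cancelling y leaves an equation inside [F j], which is read in coordinates. *)
Lemma level_conj j k (co : G -> 'cV[int]_k) y g u v :
  coords (F j) (F j.+1) co -> H g -> F j g -> F j u -> F j v ->
  F j.+1 ((g * (y * v * phi g^-1))^-1 * (y * u)) <->
  (co u - co v = co g - co (phi g))%R.
Proof.
move=> coP Hg Fg Fu Fv; have [Q [f fQ]] := quotient_exists (Fn j.+1).
have [fM _ _] := fQ; have [F1 FM FV] := sF j.
have cen := filtration_central fQ; have Fp := FV _ (phiF Hg Fg).
rewrite -(quotient_eq _ _ fQ) hom_onV //.
have Fw : F j (g * (v * (phi g)^-1)) by apply: (FM) => //; exact: FM.
have -> : f (g * (y * v * (phi g)^-1)) = f (y * (g * (v * (phi g)^-1))).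
  by rewrite !fM -!gmulA !(gmulA (f g)) (cen _ Fg) !gmulA.
have -> : (f (y * u) = f (y * (g * (v * (phi g)^-1)))) <->
          (f u = f (g * (v * (phi g)^-1))).
  by rewrite !(fM y); split=> [/gmulI | ->].
rewrite -(coords_eq (sF j) coP fQ) //; case: (coP) => coM _ _.
rewrite coM //; last exact: FM.
rewrite coM // (coordsV (sF j) coP); last exact: phiF.
split=> [-> | e]; first by rewrite addrCA [RHS]addrC addrAC subrr add0r addrC.
by rewrite addrCA -e addrC subrK.
Qed.

(** Modulo [F j] both y u and y v become y, so g stabilizes y there. *)
Lemma stab_fixed j k (co : G -> 'cV[int]_k) y g u v :
  coords (F j) (F j.+1) co -> stab phi j -> H g -> F j u -> F j v ->
  F j.+1 ((g * (y * v * phi g^-1))^-1 * (y * u)) -> F j g.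
Proof.
move=> coP st Hg Fu Fv e; apply: (st y) => //.
have [Q [f fQ]] := quotient_exists (Fn j); case: (fQ) => fM fK _.
move/FS: e => /(quotient_eq _ _ fQ) e; apply/(quotient_eq _ _ fQ).
move: e; rewrite !fM ((fK u).2 Fu) ((fK v).2 Fv) !gmulg1; exact.
Qed.

(** A g stabilizing y modulo [F j.+1] lies in [F j], and [level_conj] with u = v = 1 gives (I - M)
    co(g) = 0. Invertibility of I - M then puts g into [F j.+1]. *)
Lemma stabS j k (co : G -> 'cV[int]_k) (M : 'M[rat]_k) :
  coords (F j) (F j.+1) co -> level_matrix phi j co M ->
  (\det (1%:M - M) != 0)%R -> stab phi j -> stab phi j.+1.
Proof.
move=> coP MP dM st y g Hg e; have [F1 _ _] := sF j.
have e' : F j.+1 ((g * (y * 1 * phi g^-1))^-1 * (y * 1)) by rewrite !gmulg1.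
have Fg := stab_fixed coP st Hg F1 F1 e'.
move: e' => /(level_conj y coP Hg Fg F1 F1); rewrite subrr => e'.
case: (coP) => _ coK _; apply/coK => //.
have U : (1%:M - M)%R \in unitmx by rewrite unitmxE unitfE.
have /(congr1 (mulmx (invmx (1%:M - M)%R))) :
    ((1%:M - M) *m map_mx (intr : int -> rat) (co g) = 0)%R.
  rewrite mulmxBl mul1mx -MP // -map_mxB -e'.
  by apply/matrixP => a b; rewrite !mxE.
rewrite mulKmx // mulmx0 => /matrixP z0; apply/matrixP => a b.
by have /eqP := z0 a b; rewrite !mxE intr_eq0 => /eqP.
Qed.

(** The class of y modulo [F j] is swept out by the elements y s(z), s being a section of [co]. By
    [stab] only elements of [F j] can identify two of them, so the relation on z is congruence
    modulo the difference lattice, whatever y is. *)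
Lemma ncl_level j k (co : G -> 'cV[int]_k) p q :
  coords (F j) (F j.+1) co -> stab phi j -> ncl (tw phi j) p ->
  ncl (fun z w => difflat phi j co (z - w)%R) q -> ncl (tw phi j.+1) (p * q).
Proof.
move=> coP st np nq; case: (coP) => coM coK coS.
pose sec z := sval (constructive_indefinite_description _ (let: ex_intro2 x a b := coS z in
  ex_intro (fun x => F j x /\ co x = z) x (conj a b))).
have [secF secE] : (forall z, F j (sec z)) /\ forall z, co (sec z) = z.
  by split=> z; rewrite /sec; case: constructive_indefinite_description => ? [].
have [Q [f fQ]] := quotient_exists (Fn j).
have [Q' [f' fQ']] := quotient_exists (Fn j.+1).
case: (fQ) => fM fK _; case: (sF j) => F1 FM FV.
have [tr ts tt] := tw_equivalence j.
apply: (@ncl_fibration _ _ _ _ _ (fun y z => y * sec z) _ _ _ _ _ _ _ _ _ np nq).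
- exact: tw_equivalence.
- exact: tw_equivalence.
- by apply: lattice_equivalence; exact: difflat_lattice.
- by move=> x y; exact: twS.
- move=> y u; apply/(twE _ _ fQ); exists 1; first by case: sH.
  by rewrite ginv1 hom_on1 gmul1 gmulg1 fM ((fK _).2 (secF u)) gmulg1.
- move=> x y [g Hg e].
  have Fp : F j (phi g^-1 * ((g * (y * phi g^-1))^-1 * x) * (phi g^-1)^-1).
    have := (Fn j).2 _ (phi g^-1)^-1 e; by rewrite ginvK gmulA.
  (* The error r in x = g y phi(g^-1) r is conjugated by phi(g^-1) so that it stands next to y. *)
  exists (co (phi g^-1 * ((g * (y * phi g^-1))^-1 * x) * (phi g^-1)^-1)).
  apply/(twE _ _ fQ'); exists g => //.
  set w := _ * (phi g^-1)^-1 in Fp *.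
  have e' : f' (sec (co w)) = f' w by apply/(coords_eq (sF j) coP fQ') => //; rewrite secE.
  case: (fQ') => f'M _ _.
  rewrite (f'M g) (f'M (y * _)) (f'M y) e' -!f'M; congr f'; rewrite /w; by gnorm.
- move=> y u v; split=> [[g Hg e] | [g [Hg Fg e]]].
    have Fg := stab_fixed coP st Hg (secF u) (secF v) e.
    exists g; split=> //; rewrite -[in LHS](secE u) -[in LHS](secE v).
    exact/(level_conj y coP Hg Fg (secF u) (secF v)).
  by exists g => //; apply/(level_conj y coP Hg Fg (secF u) (secF v)); rewrite !secE.
Qed.

(** If B is a basis matrix of L_j, then C = (I - M) B is one of the difference lattice. C is
    integral because I - M sends the coordinates of h to co(h) - co(phi(h)); the indices are the
    absolute determinants of B and C. *)
Lemma level_index j k (co : G -> 'cV[int]_k) (M : 'M[rat]_k) m :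
  coords (F j) (F j.+1) co -> level_matrix phi j co M ->
  (\det (1%:M - M) != 0)%R -> (0 < m)%N -> (forall x, H (gpow x m)) ->
  exists l q, [/\ ncl (fun z w => difflat (fun _ => 1) j co (z - w)%R) l,
    ncl (fun z w => difflat phi j co (z - w)%R) q &
    (q%:R = l%:R * `|\det (1%:M - M)| :> rat)%R].
Proof.
move=> coP MP dM m0 Hm; have [F1 _ _] := sF j; have [coM coK coS] := coP.
(* For the trivial homomorphism the difference lattice is L_j itself; it contains m Z^k since all
   m-th powers lie in H. *)
pose L := difflat (fun _ => 1) j co.
have LE z : L z <-> exists h, [/\ H h, F j h & z = co h].
  by split=> -[h [Hh Fh ->]]; exists h; split=> //; rewrite (coords1 (sF j) coP) subr0.
have lL : lattice L.
  split; first by apply/LE; exists 1; rewrite (coords1 (sF j) coP); split=> //; case: sH.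
  have [[_ HM HV] [_ FM FV]] := (sH, sF j).
  move=> z w /LE [h [Hh Fh ->]] /LE [g [Hg Fg ->]]; apply/LE; exists (h * g^-1).
  have Fg' := FV _ Fg.
  split; [by apply: HM => //; exact: HV | exact: FM |].
  by rewrite coM // (coordsV (sF j) coP).
have m0' : (m%:Z != 0)%R by rewrite -lt0n.
have Lm z : L (m%:Z *: z)%R.
  have [x Fx <-] := coS z; apply/LE; exists (gpow x m); split=> //.
    exact: subg_pow.
  by rewrite (coordsX (sF j) coP).
have [B [B0 BL Bn]] := lattice_basis lL m0' Lm.
have diffE h : H h -> F j h -> map_mx (intr : int -> rat) (co h - co (phi h))%R =
    ((1%:M - M) *m map_mx intr (co h))%R.
  by move=> Hh Fh; rewrite map_mxB MP // mulmxBl mul1mx.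
have /fin_all_exists [u uP] (b : 'I_k) : exists v : 'cV[int]_k,
    map_mx (intr : int -> rat) v = ((1%:M - M) *m map_mx intr (col b B))%R.
  have /LE [h [Hh Fh e]] : L (col b B) by apply/BL; exists (delta_mx b 0%R); rewrite colE.
  by exists (co h - co (phi h))%R; rewrite diffE // e.
pose C : 'M[int]_k := (\matrix_(a, b) u b a 0)%R.
have CE : map_mx (intr : int -> rat) C = ((1%:M - M) *m map_mx intr B)%R.
  apply/matrixP => a b; have /matrixP /(_ a 0%R) := uP b.
  by rewrite !mxE => ->; apply: eq_bigr => l _; rewrite !mxE.
have detC : ((\det C)%:~R = \det (1%:M - M) * (\det B)%:~R :> rat)%R.
  by rewrite -!det_map_mx CE det_mulmx.
have C0 : (\det C != 0)%R by rewrite -(intr_eq0 rat) detC mulf_neq0 // intr_eq0.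
exists `|(\det B)%R|%N, `|(\det C)%R|%N; split=> //.
  apply: ncl_ext (lattice_index C0) => z w; split=> [[v ->] | [h [Hh Fh ->]]].
    have /LE [h [Hh Fh e]] : L (B *m v)%R by apply/BL; exists v.
    exists h; split=> //; apply: intr_mx_inj.
    by rewrite diffE // -e !map_mxM CE mulmxA.
  have /BL [v e] : L (co h) by apply/LE; exists h.
  by exists v; apply: intr_mx_inj; rewrite diffE // e !map_mxM CE mulmxA.
by rewrite !natr_absz !intr_norm detC normrM mulrC.
Qed.

(** A row vector w with w (I - M) = 0 annihilates all co(g) - co(phi(g)), so w co(u) is an invariant
    of the class of u in [F j] modulo [F j.+1], and it takes infinitely many values. *)
Lemma level_infinite j k (co : G -> 'cV[int]_k) (M : 'M[rat]_k) (E : G -> G -> Prop) m :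
  coords (F j) (F j.+1) co -> level_matrix phi j co M -> stab phi j ->
  (\det (1%:M - M) = 0)%R -> equivalence E ->
  (forall x y, E x y -> tw phi j.+1 x y) -> ~ ncl E m.
Proof.
move=> coP MP st /eqP /det0P [w w0 wM] eE Etw nE; have [coM coK coS] := coP.
have wM' : w = (w *m M)%R.
  by apply/eqP; rewrite -subr_eq0 -{1}[w]mulmx1 -mulmxBr wM.
have [i0 wi0] : exists i, w 0%R i != 0%R.
  apply/existsP; apply: contraNT w0; rewrite negb_exists => /forallP w0.
  by apply/eqP/matrixP => a i; rewrite ord1 mxE; apply/eqP; rewrite -[_ == _]negbK.
(* On these vectors w takes the distinct values t w_(i0); m + 1 of them cannot fit into m
   classes. *)
pose e (t : nat) : 'cV[int]_k := (t%:Z *: delta_mx i0 0)%R.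
have /fin_all_exists [y /all_and2 [Fy coy]] (t : 'I_m.+1) :
    exists x, F j x /\ co x = e t.
  by have [x Fx ex] := coS (e t); exists x.
have [|t [t' [tt' /Etw [g Hg Fg]]]] := ncl_pigeonhole y eE nE; first by rewrite card_ord.
have Fg' : F j.+1 ((g * (1 * y t' * phi g^-1))^-1 * (1 * y t)) by rewrite !gmul1.
have Fjg := stab_fixed coP st Hg (Fy t) (Fy t') Fg'.
move: Fg' => /(level_conj 1 coP Hg Fjg (Fy t) (Fy t')); rewrite !coy.
move=> /(congr1 (map_mx (intr : int -> rat))) /(congr1 (mulmx w)).
rewrite [in RHS]map_mxB MP // [RHS]mulmxBr mulmxA -wM' subrr.
rewrite /e -scalerBl map_mxZ map_delta_mx -scalemxAr -colE => /matrixP /(_ 0%R 0%R) /eqP.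
rewrite !mxE mulf_eq0 (negPf wi0) orbF intr_eq0 subr_eq0 => /eqP [tt].
by apply: tt'; exact: val_inj.
Qed.

End Twisted.
End Filtration.

(** * The series of isolators *)

Lemma det_castmx (R : comNzRingType) m n (e : m = n) (A : 'M[R]_m) :
  (\det (castmx (e, e) A) = \det A)%R.
Proof. by case: _ / e; rewrite castmx_id. Qed.

Lemma det_mxdiag (R : comNzRingType) m (p : 'I_m -> nat) (B : forall i, 'M[R]_(p i)) :
  (\det (\mxdiag_i B i) = \prod_i \det (B i))%R.
Proof.
elim: m p B => [|m IH] p B; last first.
  by rewrite [RHS]big_ord_recl -IH mxdiag_recl det_castmx det_ublock.
have e : (\sum_i p i)%N = 0%N by rewrite big_ord0.
by rewrite [RHS]big_ord0 -(det_castmx e) det_mx00.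
Qed.

(** * Subgroups of finite index *)

Section FiniteIndex.
Variables (G : group) (H : G -> Prop) (n : nat).
Hypotheses (sH : is_subgroup H) (idxH : index_eq H n).

Lemma index_equivalence : equivalence (fun x y : G => H (y^-1 * x)).
Proof.
case: sH => H1 HM HV; split=> [x | x y Hxy | x y z Hxy Hyz]; first by rewrite gmulV.
  by have := HV _ Hxy; gnorm.
by have := HM _ _ Hyz Hxy; gnorm.
Qed.

(** Two of x^0, ..., x^n share a coset, so x^d lies in H for some 0 < d <= n; the exponent n! is a
    multiple of every such d. *)
Lemma index_power : exists2 m, (0 < m)%N & forall x, H (gpow x m).
Proof.
exists n`!; first exact: fact_gt0.
move=> x; have [|i [j [ij Hij]]] :=
  ncl_pigeonhole (fun i : 'I_n.+1 => gpow x i) index_equivalence idxH.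
  by rewrite card_ord.
have [d /andP [d0 dn] Hd] : exists2 d, (0 < d <= n)%N & H (gpow x d).
  wlog ltij : i j ij Hij / (j < i)%N.
    move=> wl; have /eqP := ij; rewrite -val_eqE neq_ltn => /orP [] lt; last exact: (wl i j).
    apply: (wl j i) => //; first by move=> e; exact: ij.
    by case: index_equivalence => _ es _; exact: es.
  exists (i - j)%N; first by rewrite subn_gt0 ltij (leq_trans (leq_subr _ _)) // -ltnS.
  by move: Hij; rewrite -{1}(subnKC (ltnW ltij)) gpowD gmulKg.
have /dvdnP [q ->] : (d %| n`!)%N by apply: dvdn_fact; rewrite d0.
by rewrite mulnC gpowM; exact: subg_pow.
Qed.

(** The classes are the right cosets of H, while [index_eq] counts left cosets; inversion exchanges
    the two. *)
Lemma index_n_classes : n_classes H (fun _ => 1) n.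
Proof.
case: idxH => r rP; exists (fun i => (r i)^-1) => x; have [i [Hi ui]] := rP x^-1.
case: sH => _ _ HV.
have E j : twisted H (fun _ => 1) x (r j)^-1 <-> H ((r j)^-1 * x^-1).
  split=> [[g [Hg ->]] | Hj]; first by have := HV _ Hg; gnorm.
  by exists ((r j)^-1 * x^-1)^-1; split; [exact: HV | gnorm].
by exists i; split=> [|j /E]; [exact/E | exact: ui].
Qed.
End FiniteIndex.

(** * Integer powers and coordinate products *)

Section IntegerPowers.
Variable G : group.

Lemma zpow_sub (x : G) (m n : nat) : zpow x (m%:Z - n%:Z)%R = gpow x m * (gpow x n)^-1.
Proof.
elim: m n => [|m IH] [|n].
- by rewrite subrr; gnorm.
- by rewrite sub0r -NegzE gmul1.
- by rewrite subr0 ginv1 gmulg1.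
have -> : (m.+1%:Z - n.+1%:Z = m%:Z - n%:Z)%R.
  by rewrite !intS opprD addrACA subrr add0r.
by rewrite IH -[m.+1]addn1 -[n.+1]addn1 !gpowD; gnorm.
Qed.

Lemma zpowD (x : G) (z w : int) : zpow x (z + w)%R = zpow x z * zpow x w.
Proof.
have split_int (u : int) : exists m n : nat, u = (m%:Z - n%:Z)%R.
  by case: u => m; [exists m, 0%N; rewrite subr0 | exists 0%N, m.+1; rewrite sub0r NegzE].
have [[m [n ->]] [m' [n' ->]]] := (split_int z, split_int w).
have -> : ((m%:Z - n%:Z) + (m'%:Z - n'%:Z) = (m + m')%N%:Z - (n' + n)%N%:Z)%R.
  by rewrite !PoszD opprD addrACA [(- n%:Z - _)%R]addrC.
rewrite !zpow_sub !gpowD ginvM -!gmulA; congr gmul; rewrite !gmulA; congr gmul.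
have c k l : gcomm (gpow x k) (gpow x l).
  by rewrite /gcomm -!gpowD addnC.
exact: gcomm_inv (c m' n).
Qed.

Lemma subg_zpow (K : G -> Prop) (x : G) z : is_subgroup K -> K x -> K (zpow x z).
Proof.
move=> sK Kx; case: z => n; first exact: subg_pow.
by case: (sK) => _ _ KV; apply: KV; exact: subg_pow.
Qed.

Lemma subg_combo (K : G -> Prop) k (a : 'I_k -> G) z :
  is_subgroup K -> (forall j, K (a j)) -> K (combo a z).
Proof.
move=> sK Ka; case: (sK) => K1 KM _; apply: big_ind => // j _; exact: subg_zpow.
Qed.

Lemma combo0 k (a : 'I_k -> G) : combo a 0%R = 1.
Proof. by apply: (big_ind (fun x => x = 1)) => // [_ _ -> -> | j _]; rewrite ?gmul1 ?mxE. Qed.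

Lemma comboD (Q : group) (f : G -> Q) k (a : 'I_k -> G) z w :
  gmorph f -> (forall j, gcentral (f (a j))) ->
  f (combo a (z + w)%R) = f (combo a z) * f (combo a w).
Proof.
(* Centrality of the partial products of the second argument is carried along, as the factors have
   to be moved past one another. *)
move=> fM ca; pose R x y u := gcentral (f y) /\ f x = f y * f u.
suff [_ ->] : R (combo a (z + w)%R) (combo a z) (combo a w) by [].
apply: (big_ind3 R).
- by rewrite /R (gmorph1 fM) gmul1; split=> // y; rewrite /gcomm gmul1 gmulg1.
- move=> x y u x' y' u' [cy ex] [cy' ex']; split=> [q|].
    by rewrite fM; apply/gcomm_sym/gcomm_mul; apply/gcomm_sym; [exact: cy | exact: cy'].
  by rewrite !fM ex ex' -!gmulA; congr gmul; rewrite !gmulA cy'.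
- move=> j _; split; last by rewrite mxE zpowD fM.
  move=> q; apply: gcomm_sym.
  apply: (subg_zpow _ (preim_subgroup fM (centralizer_subgroup q))).
  exact/gcomm_sym/ca.
Qed.
End IntegerPowers.

(** * The isolator series of N, its coordinates and the action of phi *)

Section Isolators.
Variables (N : group) (c : nat).
Hypothesis nilN : forall x, lcs_aux (@full N) c x -> x = 1.

(** The index is shifted so that the filtration starts at 0 with N_1 = N, in step with [lcs_aux]. *)
Let Ns (j : nat) : N -> Prop := Nser j.+1.

Lemma Nser_normal j : gnormal (Ns j).
Proof. exact: isolator_lcs_normal nilN j. Qed.

Lemma Nser0 x : Ns 0 x.
Proof. by split=> //; exists 1%N. Qed.

Lemma Nser_dec j x : Ns j.+1 x -> Ns j x.
Proof. by case=> _ [m [m0 Lx]]; split=> //; exists m; split=> //; exact: lcs_decS Lx. Qed.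

Lemma Nser_commg j g x : Ns j x -> Ns j.+1 (commg g x).
Proof. exact: (isolator_lcs_commg nilN). Qed.

(** Coordinates are chosen by description; their uniqueness turns the rule [comboD] for products of
    the central images of the basis into additivity. *)
Lemma malcev_coords j k (a : 'I_k -> N) : malcev_level j.+1 a ->
  exists co : N -> 'cV[int]_k, coords (Ns j) (Ns j.+1) co /\
    forall x, Ns j x -> Ns j.+1 ((combo a (co x))^-1 * x).
Proof.
move=> [aN aP].
have tot x : exists z, Ns j x -> Ns j.+1 ((combo a z)^-1 * x).
  have [/aP [z [Nz _]] | no] := classic (Ns j x); first by exists z.
  by exists 0%R.
pose co x := sval (constructive_indefinite_description _ (tot x)).
have coP x : Ns j x -> Ns j.+1 ((combo a (co x))^-1 * x).
  by rewrite /co; case: constructive_indefinite_description.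
have [Q [f fQ]] := quotient_exists (Nser_normal j.+1).
have [fM fK _] := fQ; have [[N1 NM NV] _] := Nser_normal j.
have ca i : gcentral (f (a i)).
  by apply: (filtration_central Nser_commg fQ); exact: aN.
have fco x : Ns j x -> f x = f (combo a (co x)).
  by move=> /coP; move/(quotient_eq _ _ fQ).
have coE x z : Ns j x -> f x = f (combo a z) -> co x = z.
  move=> Nx /(quotient_eq _ _ fQ) Nz; have [w [_ uw]] := aP x Nx.
  by rewrite -(uw _ (coP _ Nx)) -(uw _ Nz).
exists co; split=> //; split.
- move=> x y Nx Ny; apply: coE; first exact: NM.
  by rewrite comboD // fM (fco x) // (fco y).
- move=> x Nx; split=> [e | /fK e].
    by apply/fK; rewrite fco // e combo0 (gmorph1 fM).
  by apply: coE => //; rewrite combo0 (gmorph1 fM).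
- move=> z; exists (combo a z); last by apply: coE => //; apply: subg_combo (Nser_normal j).1 aN.
  exact: subg_combo (Nser_normal j).1 aN.
Qed.

Variables (H : N -> Prop) (phi : N -> N).
Hypotheses (sH : is_subgroup H) (homphi : hom_on H phi).
Hypothesis powH : exists2 m, (0 < m)%N & forall x, H (gpow x m).

(** Some power of x lies in gamma_(j+1)(N), and a further power in gamma_(j+1)(H) by [lcs_power],
    all of N having powers in H. *)
Lemma Hser_Nser j x : H x -> Ns j x -> Hser H j.+1 x.
Proof.
move=> Hx [_ [m [m0 Lx]]]; split=> //.
have pw y : full y -> exists2 m, (0 < m)%N & H (gpow y m).
  by case: powH => r r0 Hr _; exists r.
have gen_full y : gen (@full N) y by exact: gen_mem.
have [r r0 Lr] := lcs_power gen_full sH pw nilN Lx.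
by exists (m * r)%N; rewrite muln_gt0 m0 gpowM.
Qed.

Lemma hom_on_lcs j x : lcs_aux H j x -> H x /\ lcs_aux (@full N) j (phi x).
Proof.
have phi1 := hom_on1 sH homphi; have phiV := hom_onV sH homphi.
have [H1 HM HV] := sH.
elim: j x => [|j IH] x; first by [].
have [L1 LM LV] := lcs_subgroup j.+1 (full_subgroup N).
move=> Lx; apply: (Lx (fun x => H x /\ lcs_aux (@full N) j.+1 (phi x))).
  split; first by rewrite phi1.
  - by move=> y z [Hy Ly] [Hz Lz]; rewrite homphi //; split; [exact: HM | exact: LM].
  - by move=> y [Hy Ly]; rewrite phiV //; split; [exact: HV | exact: LV].
move=> _ [a [b [Ha /IH [Hb Lb] ->]]].
have [Ha' Hb' Hab] := And3 (HV _ Ha) (HV _ Hb) (HM _ _ Ha Hb).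
have Hbab := HM _ _ Hb' Hab; split; first exact: HM.
by rewrite /commg !homphi // !phiV //; exact: (lcs_commg (K := @full N)).
Qed.

(** Since phi is a homomorphism only on H, the argument passes through a power of h in
    gamma_(j+1)(H), which phi maps into gamma_(j+1)(N). *)
Lemma hom_on_Nser j h : H h -> Ns j h -> Ns j (phi h).
Proof.
move=> Hh /(Hser_Nser Hh) [_ [m [m0 Lm]]]; split=> //; exists m; split=> //.
have <- : phi (gpow h m) = gpow (phi h) m; last by have [] := hom_on_lcs Lm.
elim: m {m0 Lm} => [|m IH] /=; first exact: (hom_on1 sH homphi).
by rewrite homphi ?IH //; exact: subg_pow.
Qed.

Lemma induced_level_matrix j k (a : 'I_k -> N) (M : 'M[rat]_k) (co : N -> 'cV[int]_k) :
  induced_matrix H phi j.+1 a M ->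
  (forall x, Ns j x -> Ns j.+1 ((combo a (co x))^-1 * x)) ->
  level_matrix H Ns phi j co M.
Proof.
move=> MP coP h Hh Nh; apply: (MP h); first exact: Hser_Nser.
  exact: coP.
by apply: coP; exact: hom_on_Nser.
Qed.

End Isolators.

Lemma tw_twisted (G : group) (H : G -> Prop) (F : nat -> G -> Prop) phi j :
  (forall x, F j x <-> x = 1) -> forall x y, tw H F phi j x y <-> twisted H phi x y.
Proof.
move=> F1 x y; split=> [[g Hg /F1 e] | [g [Hg ->]]].
  by exists g; split=> //; apply: (@gmulI _ (g * (y * phi g^-1))^-1); rewrite gmulV.
by exists g => //; apply/F1; rewrite gmulV.
Qed.

Local Close Scope grp_scope.
Local Open Scope ring_scope.

(** * The product formula, by climbing the isolator series *)

Theorem mainTheorem3 (N : group) (c : nat)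
  (fgN : finitely_generated N) (tfN : torsion_free N) (clN : nilpotent_class N c)
  (H : N -> Prop) (subH : is_subgroup H) (n : nat) (idxH : index_eq H n)
  (phi : N -> N) (homphi : hom_on H phi)
  (k : nat -> nat) (a : forall i : nat, 'I_(k i) -> N)
  (basis : forall i, (1 <= i <= c)%N -> malcev_level i (a i))
  (M : forall i : nat, 'M[rat]_(k i))
  (HM : forall i, (1 <= i <= c)%N -> induced_matrix H phi i (a i) (M i)) :
  reidemeister_is H phi
    (mul_inf n (abs_inf (\det (1%:M - \mxdiag_(j < c) M j.+1)))).
Proof.
have nilN : forall x, lcs_aux (@full N) c x -> x = gone N := clN.1.
pose F j := @Nser N j.+1; pose one1 := fun _ : N => gone N.
have Fn : forall j, gnormal (F j) := Nser_normal nilN.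
have F0 : forall x, F 0 x := @Nser0 N.
have FS : forall j x, F j.+1 x -> F j x := @Nser_dec N.
have FC : forall j g x, F j x -> F j.+1 (Defs.commg g x) := Nser_commg nilN.
have Fdec i j x : (i <= j)%N -> F j x -> F i x.
  elim: j => [|j IH]; first by rewrite leqn0 => /eqP ->.
  by rewrite leq_eqVlt => /orP [/eqP -> // | ij /FS]; exact: IH.
have F1 j : F j (gone N) by have [[]] := Fn j.
(* [F c] is N_(c+1), the set of torsion elements, so it is trivial. *)
have Fc x : F c x <-> x = gone N.
  split=> [[_ [m [m0 /nilN /(tfN _ _ m0)]]] // | ->]; exact: F1.
have powH := index_power subH idxH; have [m m0 Hm] := powH.
have phiF : forall j h, H h -> F j h -> F j (phi h) := hom_on_Nser nilN subH homphi powH.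
have level j : (j < c)%N -> exists co,
    coords (F j) (F j.+1) co /\ level_matrix H F phi j co (M j.+1).
  move=> jc; have [co [coP coF]] := malcev_coords nilN (basis j.+1 jc).
  exists co; split=> //; exact: (induced_level_matrix nilN subH homphi powH (HM j.+1 jc)).
have hom1 : hom_on H one1 by move=> x y _ _; rewrite gmul1.
have one1F j h : H h -> F j h -> F j (one1 h) by move=> _ _; exact: F1.
(* The trivial homomorphism has matrix 0 on each level, hence determinant 1, so its stabilizer
   condition holds throughout. *)
have one1M j k' (co : N -> 'cV[int]_k') : coords (F j) (F j.+1) co ->
    level_matrix H F one1 j co 0.
  move=> coP h _ _; rewrite mul0mx (coords1 (Fn j).1 coP).
  by apply/matrixP => s t; rewrite !mxE.
pose d j := \det (1%:M - M j.+1).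
have stab_phi j : (j <= c)%N -> (forall i, (i < j)%N -> d i != 0) -> stab H F phi j.
  elim: j => [|j IH] jc dj; first by move=> y g _ _; exact: F0.
  have [co [coP MP]] := level j jc.
  apply: (stabS subH Fn FS FC homphi phiF coP MP); first exact: dj.
  by apply: IH; [exact: ltnW | move=> i ij; apply: dj; exact: ltnW].
have stab_one j : (j <= c)%N -> stab H F one1 j.
  elim: j => [|j IH] jc; first by move=> y g _ _; exact: F0.
  have [co [coP _]] := level j jc.
  apply: (stabS subH Fn FS FC hom1 one1F coP (one1M _ _ _ coP)); last exact: IH (ltnW jc).
  by rewrite subr0 det1 oner_eq0.
(* Both homomorphisms are counted side by side: the lattice indices enter both counts and only the
   determinants separate them. *)
have count j : (j <= c)%N -> (forall i, (i < j)%N -> d i != 0) ->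
    exists p r, [/\ ncl (tw H F phi j) p, ncl (tw H F one1 j) r &
      p%:R = r%:R * \prod_(i < j) `|d i| :> rat].
  elim: j => [|j IH] jc dj.
    have one_class psi : ncl (tw H F psi 0) 1.
      exists (fun _ => gone N) => x; exists ord0; split=> [|i _]; last by rewrite [i]ord1.
      by exists (gone N); [case: subH | exact: F0].
    by exists 1%N, 1%N; rewrite big_ord0 mulr1.
  have [|p [r [np nr epr]]] := IH (ltnW jc); first by move=> i ij; apply: dj; exact: ltnW.
  have [co [coP MP]] := level j jc.
  have [l [q [nl nq elq]]] :=
    level_index subH Fn coP MP (dj j (ltnSn j)) m0 Hm.
  exists (p * q)%N, (r * l)%N; split.
  - apply: (ncl_level subH Fn FS FC homphi phiF coP _ np nq).
    by apply: stab_phi (ltnW jc) _ => i ij; apply: dj; exact: ltnW.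
  - exact: (ncl_level subH Fn FS FC hom1 one1F coP (stab_one _ (ltnW jc)) nr nl).
  - by rewrite !natrM epr elq big_ord_recr /= -/(d j) mulrACA.
have -> : \det (1%:M - \mxdiag_(j < c) M j.+1) = \prod_(j < c) d j.
  by rewrite -mxdiagZ -mxdiagB det_mxdiag.
have tw_eq psi (hpsi : hom_on H psi) j : equivalence (tw H F psi j).
  exact: (tw_equivalence subH Fn hpsi).
have twP psi : forall x y, tw H F psi c x y <-> twisted H psi x y by exact: tw_twisted.
rewrite /abs_inf; case: eqP => [/eqP | /eqP].
  move=> /prodf_eq0 [j0 _ dj0] m' /=.
  have ex0 : exists j, (j < c)%N && (d j == 0) by exists j0; rewrite ltn_ord.
  case: (ex_minnP ex0) => j /andP [jc /eqP dj] jmin nm.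
  have [co [coP MP]] := level j jc.
  (* At the least level with vanishing determinant the stabilizer condition is still available from
     below. *)
  have st : stab H F phi j.
    apply: stab_phi (ltnW jc) _ => i ij; apply/negP => di.
    by have := jmin i; rewrite di (ltn_trans ij jc) leqNgt ij => /(_ isT).
  apply: (level_infinite subH Fn FS FC homphi phiF coP MP st dj (tw_eq _ homphi c)).
    by move=> x y [g Hg Fg]; exists g => //; exact: Fdec jc Fg.
  by apply: ncl_ext nm => x y; apply: iff_sym; exact: twP.
move=> /prodf_neq0 d0.
have [|p [r [np nr epr]]] := count c (leqnn c); first by move=> i ic; exact: (d0 (Ordinal ic)).
(* At the top the count for the trivial homomorphism is the index of H. *)
have er : r = n.
  apply: (ncl_unique (tw_eq _ hom1 c) nr).
  by apply: ncl_ext (index_n_classes subH idxH) => x y; apply: iff_sym; exact: twP.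
exists p; split; first by rewrite epr er normr_prod.
by apply: ncl_ext np => x y; exact: twP.
Qed.
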